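(* There exists $n_0$ such that for all integers $n\ge n_0$, the threshold $t^+(n,\mathcal C)$ of the strict Oriented-cycle game on $K_n$ satisfies $t^+(n,\mathcal C)\le \frac{19n}{20}-1$.
   Context: The strict $b$-biased Oriented-cycle game on $K_n$ ($b\ge 1$ an integer): two players, OMaker and OBreaker, alternately direct previously undirected edges of the complete graph $K_n$. OMaker moves first. In each of her moves OMaker directs exactly one previously undirected edge; in each of his moves OBreaker directs exactly $b$ previously undirected edges (if fewer than $b$ undirected edges remain, he directs all of them). Each player chooses the orientation of every edge he or she directs. The game ends when all edges are directed, so that the result is a tournament on $n$ vertices. OMaker wins if the final tournament has the property $\mathcal C$ of containing a directed cycle; otherwise (the final tournament is transitive) OBreaker wins. $t^+(n,\mathcal C)$ denotes the largest integer $b$ such that OMaker has a winning strategy in the strict $b$-biased Oriented-cycle game on $K_n$. *)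

(* Defs.v *)
From mathcomp Require Import all_boot.
From mathcomp Require Import boolp.
From mathcomp Require classical_sets.

Set Implicit Arguments.
Unset Strict Implicit.
Unset Printing Implicit Defensive.

(* The arc (u, v) is the edge uv of K_n directed from u to v. *)
Definition arc (n : nat) : Type := ('I_n * 'I_n)%type.

(* A position is the set of arcs directed so far. *)
Definition position (n : nat) : Type := {set 'I_n * 'I_n}.

Definition edge (n : nat) (a : arc n) : {set 'I_n} := [set a.1; a.2].

Definition complete_edges (n : nat) : {set {set 'I_n}} :=
  [set e : {set 'I_n} | #|e| == 2].

Definition undirected (n : nat) (D : position n) : {set {set 'I_n}} :=
  complete_edges n :\: [set edge a | a in D].

(* S is a legal choice of arcs for a player who has to direct exactly k edges
   at position D (all of them if fewer than k are undirected).  Injectivity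
   says that no edge receives both orientations. *)
Definition legal_move (n k : nat) (D S : position n) : Prop :=
  [/\ [set edge a | a in S] \subset undirected D,
      {in S &, injective (@edge n)}
    & #|S| = minn k #|undirected D|].

Definition has_dicycle (n : nat) (D : position n) : Prop :=
  exists2 s : seq 'I_n, s != [::] & ucycle (fun u v => (u, v) \in D) s.

(* An OMaker strategy gives the arc to be played as a function of the whole
   history: all positions that have occurred, the most recent one first. *)
Definition strategy (n : nat) : Type := seq (position n) -> arc n.

(* Histories of partial plays in which OMaker follows f, OBreaker makes
   arbitrary legal moves, and OMaker is to move (or the game has ended).
   If OMaker directs the last edge, OBreaker's reply in that round is empty. *)
Inductive history (n b : nat) (f : strategy n) : seq (position n) -> Prop :=
| history_start : history b f [:: set0]
| history_round (D : position n) (h : seq (position n)) (S : position n) :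
    history b f (D :: h) ->
    undirected D != set0 ->
    legal_move b (f (D :: h) |: D) S ->
    history b f [:: (f (D :: h) |: D) :|: S, f (D :: h) |: D, D & h].

Definition winning_strategy (n b : nat) (f : strategy n) : Prop :=
  forall (D : position n) (h : seq (position n)), history b f (D :: h) ->
    if undirected D == set0 then has_dicycle D
    else legal_move 1 D [set f (D :: h)].

Definition OMaker_wins (n b : nat) : Prop :=
  exists f : strategy n, winning_strategy b f.

Definition is_threshold (n t : nat) : Prop :=
  [/\ 0 < t, OMaker_wins n t
    & forall b : nat, 0 < b -> OMaker_wins n b -> b <= t].

(* t^+(n, C); 0 when OMaker wins for no b >= 1 (see t_plus_is_threshold). *)
Definition t_plus (n : nat) : nat :=
  classical_sets.xget 0 (is_threshold n).

Lemma edgeP (n : nat) (a c : arc n) :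
  edge a = edge c -> a = c \/ a = (c.2, c.1).
Proof.
case: a c => [a1 a2] [c1 c2] /setP E; rewrite /edge /= in E *.
have := E a1; have := E a2; have := E c1; have := E c2.
rewrite !inE /= !eqxx ?orbT /=.
move=> /orP H1 /orP H2 /esym/orP H3 /esym/orP H4.
case: H1 H2 H3 H4 => /eqP H1 [] /eqP H2 [] /eqP H3 [] /eqP H4;
  rewrite /=; (left; congruence) || (right; congruence).
Qed.

Lemma dicycle_rank (n : nat) (D : position n) (r : 'I_n -> nat) :
  (forall u v, (u, v) \in D -> r u < r v) -> ~ has_dicycle D.
Proof.
move=> rD [[//|x s] _ /andP[/= + _]].
have H : forall y p, path (fun u v => (u, v) \in D) y p ->
    r y + (p != [::]) <= r (last y p).
  move=> y p; elim: p y => [|z p IH] y /=; first by rewrite addn0.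
  move=> /andP[/rD yz /IH]; rewrite addn1 => zp.
  by apply: leq_trans yz _; apply: leq_trans zp; apply: leq_addr.
move/H; rewrite last_rcons -size_eq0 size_rcons /= addn1.
by rewrite ltnn.
Qed.

Lemma OMaker_loses_large (n b : nat) :
  #|complete_edges n| <= b -> ~ OMaker_wins n b.
Proof.
move=> Hb [f W].
have := W set0 [::] (history_start b f).
case: eqP => [_|/eqP U0].
  by apply: (@dicycle_rank n set0 (fun=> 0)) => u v; rewrite inE.
set a := f _ => -[aU _ _].
have aE : #|edge a| = 2.
  have := subsetP aU (edge a).
  by rewrite imset_set1 set11 !inE => /(_ isT) /andP[_ /eqP].
have a12 : a.1 != a.2.
  by move: aE; rewrite /edge cards2; case: eqP.
pose r (u : 'I_n) : nat := if a.1 < a.2 then val u else n - val u.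
have rI : injective r.
  move=> u v; rewrite /r; case: ifP => _; first by move/val_inj.
  move=> E; apply: val_inj.
  by rewrite /= -(subKn (ltnW (ltn_ord u))) E (subKn (ltnW (ltn_ord v))).
have ra : r a.1 < r a.2.
  rewrite /r; case: (ltngtP a.1 a.2) => // [h|/val_inj h].
    by apply: ltn_sub2l h; apply: ltn_ord.
  by rewrite h eqxx in a12.
pose T : position n := [set c : arc n | r c.1 < r c.2].
pose D1 : position n := a |: set0.
pose S := T :\: D1.
have TI : {in T &, injective (@edge n)}.
  move=> c d; rewrite !inE => Hc Hd /edgeP[//|E].
  by move: Hc; rewrite E /= => /(ltn_trans Hd); rewrite ltnn.
have D1T : D1 \subset T.
  by apply/subsetP=> c; rewrite !inE orbF => /eqP->.
have Tfull : [set edge c | c in T] = complete_edges n.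
  apply/setP=> e; apply/imsetP/idP => [[c + ->]|].
    rewrite !inE => Hc; rewrite /edge cards2.
    by have -> : c.1 != c.2 by apply: contraTneq Hc => ->; rewrite ltnn.
  rewrite [e \in _]in_set => /cards2P[x [y [xy ->]]].
  have : r x != r y by apply: contraNneq xy => /rI ->.
  rewrite neq_ltn => /orP[h|h].
    by exists (x, y); rewrite ?inE.
  by exists (y, x); rewrite ?inE // /edge setUC.
have Simg : [set edge c | c in S] = undirected D1.
  apply/setP=> e; rewrite in_setD -Tfull.
  apply/imsetP/andP => [[c]|[N]].
    rewrite in_setD => /andP[cD cT] ->; split; last exact: imset_f.
    apply/negP=> /imsetP[d dD E].
    have E' := TI _ _ cT (subsetP D1T _ dD) E.
    by rewrite E' dD in cD.
  case/imsetP=> c cT E; exists c => //; rewrite in_setD cT andbT.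
  by apply: contra N => cD; rewrite E imset_f.
have SI : {in S &, injective (@edge n)}.
  by move=> c d; rewrite !in_setD => /andP[_ ?] /andP[_ ?]; apply: TI.
have L : legal_move b D1 S.
  split; rewrite ?Simg // (minn_idPr _) -?Simg ?card_in_imset //.
  rewrite -(card_in_imset SI) Simg; apply: leq_trans Hb.
  by apply: subset_leq_card; apply: subsetDl.
have Hh := history_round (history_start b f) U0 L.
have ET : D1 :|: S = T.
  by rewrite /S -{1}(setIidPr D1T) setID.
have := W _ _ Hh; rewrite -/a -/D1 ET.
rewrite /undirected Tfull setDv eqxx.
by apply: (@dicycle_rank n T r) => u v; rewrite inE.
Qed.

Lemma t_plus_is_threshold (n : nat) :
  (exists2 b, 0 < b & OMaker_wins n b) -> is_threshold n (t_plus n).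
Proof.
move=> [b b0 Wb]; apply: classical_sets.xgetPex.
pose P c := (0 < c) && `[< OMaker_wins n c >].
have exP : exists c, P c by exists b; rewrite /P b0; apply/asboolP.
have ubP c : P c -> c <= #|complete_edges n|.
  move=> /andP[_ /asboolP Wc]; rewrite leqNgt; apply/negP=> /ltnW h.
  exact: OMaker_loses_large h Wc.
case: (ex_maxnP exP ubP) => t /andP[t0 /asboolP Wt] tmax.
exists t; split=> // c c0 Wc; apply: tmax; rewrite /P c0; exact/asboolP.
Qed.

(* Main.v *)
(** With d about n/20, OBreaker keeps the position equal to an interval order in
    which d vertices Y start right of a point lam, every point between lam and
    the right end of the order is covered by at least d intervals of Y, and most
    of the other intervals start at a common left end and reach lam.  If OMaker
    directs an edge between two overlapping intervals, OBreaker separates them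
    by a cut at a common point q.  This adds at most n + 1 - N(q) arcs, where
    N(q) counts the intervals through q; as N(q) is large, part of the b + 1
    arcs of the round is left over.  He spends the rest on moving vertices straddling
    lam entirely to its left, each at the price of exactly #|Y| arcs, and makes
    the total exact by shortening one more interval, which works because the
    left ends in (0, lam] are distinct.  Once no vertex straddles lam, the two
    sides are independent and of size at most b + 1, and arcs can be added one
    at a time.  The stock of intervals with the common left end shrinks by at
    most two per round, and numerical estimates show that it outlasts the
    straddling vertices. *)

Require Import Defs.
From mathcomp Require Import all_boot all_order all_algebra.
From mathcomp Require Import zify lra.
From mathcomp Require classical_sets.
Import Order.TTheory GRing.Theory Num.Theory.
Set Implicit Arguments.
Unset Strict Implicit.
Unset Printing Implicit Defensive.

(** * Counts as sums of indicators, compared termwise *)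

Definition cnt (T : finType) (P : pred T) : nat := \sum_v (P v : nat).

Lemma cnt_pred1 (T : finType) (x : T) : cnt (pred1 x) = 1.
Proof. by rewrite /cnt (bigD1 x) //= eqxx big1 // => v /negPf ->. Qed.

Lemma cntT (T : finType) : cnt (@predT T) = #|T|.
Proof. by rewrite /cnt sum1_card. Qed.

Lemma cnt_gt0 (T : finType) (P : pred T) : 0 < cnt P -> exists v, P v.
Proof.
move=> h; case: (pickP P) => [v Pv|nP]; first by exists v.
by move: h; rewrite /cnt big1 // => v _; rewrite nP.
Qed.

Lemma cnt_lt (T : finType) (P Q : pred T) :
  cnt P < cnt Q -> exists2 v, Q v & ~~ P v.
Proof.
move=> h; case: (pickP (fun v => Q v && ~~ P v)) => [v /andP[Qv Pv]|nP].
  by exists v.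
move: h; rewrite ltnNge => /negP[]; apply: leq_sum => v _.
by move: (nP v); case: (P v) (Q v) => [] [].
Qed.

(** * Interval orders *)

(* The position in which [v] is joined to [w] exactly when the interval
   [lo v, hi v] lies strictly to the left of [lo w, hi w]; an edge is undirected
   iff its two intervals overlap.  [lam] separates the two ends of the order and
   [top] is the right end of all intervals that still straddle [lam]. *)
Record state (T : Type) :=
  State { lo : T -> nat; hi : T -> nat; lam : nat; top : nat }.

Definition arcs (T : finType) (s : state T) : {set T * T} :=
  [set a | hi s a.1 < lo s a.2].

Definition ext (T : finType) (s s' : state T) (k : nat) : Prop :=
  arcs s \subset arcs s' /\ #|arcs s'| = #|arcs s| + k.

Lemma ext_refl (T : finType) (s : state T) : ext s s 0.
Proof. by split; rewrite ?addn0. Qed.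

Lemma ext_trans (T : finType) (s1 s2 s3 : state T) (j k : nat) :
  ext s1 s2 j -> ext s2 s3 k -> ext s1 s3 (j + k).
Proof.
move=> [a b] [c e]; split; first exact: subset_trans c.
by rewrite e b addnA.
Qed.

Lemma card_arcs (T : finType) (s : state T) :
  #|arcs s| = \sum_u cnt (fun v => hi s u < lo s v).
Proof.
rewrite /cnt pair_big -sum1_card big_mkcond /=.
by apply: eq_bigr => -[u v] _; rewrite inE /=; case: ifP.
Qed.

(* The same position with gaps between the endpoints. *)
Definition dbl (T : finType) (s : state T) : state T :=
  State (fun v => (lo s v).*2) (fun v => (hi s v).*2.+1)
        (lam s).*2.+1 (top s).*2.+1.

Definition sethi (T : finType) (s : state T) (x : T) (p : nat) : state T :=
  State (lo s) (fun v => if v == x then p else hi s v) (lam s) (top s).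

Definition setlo (T : finType) (s : state T) (x : T) (p : nat) : state T :=
  State (fun v => if v == x then p else lo s v) (hi s) (lam s) (top s).

(** Doubling makes room at [q]: [v] ends at [2q] and [w] begins right after it. *)
Definition cut (T : finType) (s : state T) (v w : T) (q : nat) : state T :=
  setlo (sethi (dbl s) v q.*2) w q.*2.+1.

Lemma ext_dbl (T : finType) (s : state T) : ext s (dbl s) 0.
Proof.
have E : arcs (dbl s) = arcs s by apply/setP => a; rewrite !inE /=; lia.
by split; rewrite E ?addn0.
Qed.

Lemma ext_sethi (T : finType) (s : state T) (x : T) (p : nat) :
  p <= hi s x ->
  ext s (sethi s x p) (cnt (fun v => p < lo s v <= hi s x)).
Proof.
move=> px; split.
  by apply/subsetP => -[u v]; rewrite !inE /=; case: eqP => [->|_]; lia.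
rewrite !card_arcs (bigD1 x) //= [in RHS](bigD1 x) //= eqxx addnAC.
congr (_ + _).
  by rewrite /cnt -big_split /=; apply: eq_bigr => v _; lia.
by apply: eq_bigr => u /negPf ->.
Qed.

Lemma ext_setlo (T : finType) (s : state T) (x : T) (p : nat) :
  lo s x <= p ->
  ext s (setlo s x p) (cnt (fun u => lo s x <= hi s u < p)).
Proof.
move=> px; split.
  by apply/subsetP => -[u v]; rewrite !inE /=; case: eqP => [->|_]; lia.
rewrite !card_arcs /cnt -big_split /=; apply: eq_bigr => u _.
rewrite (bigD1 x) //= [in RHS](bigD1 x) //= eqxx addnAC; congr (_ + _).
  by lia.
by apply: eq_bigr => v /negPf ->.
Qed.

Definition overlap (T : finType) (s : state T) (v w : T) : Prop :=
  [/\ v != w, lo s v <= hi s w & lo s w <= hi s v].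

Lemma ext_cut (T : finType) (s : state T) (v w : T) (q : nat) :
  v != w -> lo s v <= q <= hi s v -> lo s w <= q <= hi s w ->
  ext s (cut s v w q)
    (cnt (fun y => q < lo s y <= hi s v)
     + cnt (fun x => lo s w <= hi s x < q)).+1.
Proof.
move=> vw vq wq; have E1 := ext_dbl s.
have px : q.*2 <= hi (dbl s) v by rewrite /=; lia.
have E2 := ext_trans E1 (ext_sethi px).
have py : lo (sethi (dbl s) v q.*2) w <= q.*2.+1 by rewrite /=; lia.
have := ext_trans E2 (ext_setlo py); rewrite /= -addnS add0n.
rewrite (_ : cnt _ = cnt (fun y => q < lo s y <= hi s v)); last first.
  by apply: eq_bigr => y _; lia.
(* The extra arc is the one from [v] to [w]: after the first move [v] ends at [2q], just before the
   new left end of [w]. *)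
rewrite (_ : cnt (fun u => _ <= (if u == v then _ else _) < _)
           = (cnt (fun x => lo s w <= hi s x < q)).+1) //.
rewrite -[RHS]addn1 -(cnt_pred1 v) /cnt -big_split /=.
by apply: eq_bigr => x _; case: eqP => [->|_]; lia.
Qed.

Lemma mem_cut (T : finType) (s : state T) (v w : T) (q : nat) :
  v != w -> (v, w) \in arcs (cut s v w q).
Proof. by move=> vw; rewrite inE /= !eqxx. Qed.

(* [X] lies left of [lam], [Y] right of it, and [U] straddles it.  The distinct
   left ends of [J] are the positions to which right ends are moved to add a
   prescribed number of arcs; [Z] supplies new elements of [J]. *)
Definition cX (T : finType) (s : state T) := cnt (fun v => hi s v <= lam s).
Definition cY (T : finType) (s : state T) := cnt (fun v => lam s < lo s v).
Definition cU (T : finType) (s : state T) :=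
  cnt (fun v => lo s v <= lam s < hi s v).
Definition cJ (T : finType) (s : state T) :=
  cnt (fun v => 0 < lo s v <= lam s).
Definition cZ (T : finType) (s : state T) :=
  cnt (fun v => (lo s v == 0) && (lam s <= hi s v)).

(** [mid_top] fixes the price of moving a straddling vertex to the left, [lo_inj] allows arc totals
    to be tuned in steps of one, and [upper_cover] bounds the price of a cut right of [lam]. *)
Record core (T : finType) (d : nat) (s : state T) : Prop := Core {
  lo_hi : forall v, lo s v <= hi s v;
  hi_top : forall v, hi s v <= top s;
  mid_top : forall v, lo s v <= lam s < hi s v -> hi s v = top s;
  lo_inj : forall u v, 0 < lo s u <= lam s -> lo s u = lo s v -> u = v;
  upper_cover : forall p, lam s < p <= top s ->
    d <= cnt (fun v => (lam s < lo s v) && (lo s v <= p <= hi s v)) }.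

Lemma core_dbl (T : finType) (d : nat) (s : state T) :
  core d s -> core d (dbl s).
Proof.
case=> H1 H2 H3 H4 H5; split=> /=.
- by move=> v; have := H1 v; lia.
- by move=> v; have := H2 v; lia.
- by move=> v h; have := H3 v; lia.
- by move=> u v h1 h2; apply: H4; lia.
- move=> p h; have /H5 : lam s < p./2 <= top s by lia.
  by move/leq_trans; apply; apply: leq_sum => v _; lia.
Qed.

Lemma cXUY (T : finType) (s : state T) :
  (forall v, lo s v <= hi s v) -> cX s + cU s + cY s = #|T|.
Proof.
move=> H; rewrite -cntT /cX /cU /cY /cnt -!big_split /=.
by apply: eq_bigr => v _; have := H v; lia.
Qed.

Lemma cZ_le (T : finType) (s : state T) : cZ s <= cX s + cU s.
Proof. by rewrite /cnt -big_split /=; apply: leq_sum => v _; lia. Qed.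

Lemma core_cY (T : finType) (d : nat) (s : state T) :
  core d s -> 0 < cU s -> d <= cY s.
Proof.
case=> H1 H2 H3 H4 H5 /cnt_gt0[v hv].
have /H5 : lam s < top s <= top s by have := H2 v; lia.
by move/leq_trans; apply; apply: leq_sum => x _; lia.
Qed.

Lemma core_sethi (T : finType) (d : nat) (s : state T) (x : T) (p : nat) :
  core d s -> lo s x <= p <= lam s -> p <= hi s x -> core d (sethi s x p).
Proof.
case=> H1 H2 H3 H4 H5 hp px; split=> /=.
- by move=> v; have := H1 v; case: eqP => [->|_]; lia.
- by move=> v; have := H2 v; case: eqP => [->|_]; lia.
- by move=> v; have := H3 v; case: eqP => [->|_]; lia.
- exact: H4.
- move=> p' /H5/leq_trans; apply; apply: leq_sum => v _.
  by case: eqP => [->|_]; lia.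
Qed.

Lemma core_setlo (T : finType) (d : nat) (s : state T) (x : T) (p : nat) :
  core d s -> 0 < p <= lam s -> lo s x <= lam s -> p <= hi s x ->
  (forall v, lo s v != p) -> core d (setlo s x p).
Proof.
case=> H1 H2 H3 H4 H5 hp lx px np; split=> /=.
- by move=> v; have := H1 v; case: eqP => [->|_]; lia.
- exact: H2.
- by move=> v; have := H3 v; case: eqP => [->|_]; lia.
- move=> u v; move: (H4 u v) (np u) (np v).
  case: (u =P x) => [->|_]; case: (v =P x) => [->|_] // Huv nu nv h E; lia.
- move=> p' /H5/leq_trans; apply; apply: leq_sum => v _.
  by case: eqP => [->|_]; lia.
Qed.

(** By [mid_top] the raised interval reaches from just after [lam] to [top], so it adds one to the
    cover of every point there. *)
Lemma core_raise (T : finType) (d : nat) (s : state T) (x : T) :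
  core d s -> lo s x <= lam s < hi s x -> core d.+1 (setlo s x (lam s).+1).
Proof.
case=> H1 H2 H3 H4 H5 hx; split=> /=.
- by move=> v; have := H1 v; case: eqP => [->|_]; lia.
- exact: H2.
- by move=> v; have := H3 v; case: eqP => [->|_]; lia.
- move=> u v; move: (H4 u v).
  case: (u =P x) => [->|_]; case: (v =P x) => [->|_] // Huv h E; lia.
- move=> p hp; have h := H5 p hp.
  rewrite -[d.+1]addn1 -(cnt_pred1 x).
  apply: leq_trans (leq_add h (leqnn _)) _.
  rewrite /cnt -big_split /=; apply: leq_sum => v _.
  by have := H3 x; case: eqP => [->|_]; lia.
Qed.

Lemma core_cut_low (T : finType) (d : nat) (s : state T) (v w : T) (q : nat) :
  core d s -> v != w -> lo s v <= q <= hi s v -> lo s w <= q <= hi s w ->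
  q <= lam s -> core d (cut s v w q).
Proof.
move=> /core_dbl c vw vq wq ql; rewrite /cut.
apply: core_setlo; rewrite /= ?[w == v]eq_sym ?(negPf vw); try lia.
by apply: core_sethi => //=; lia.
Qed.

Lemma core_cut_up (T : finType) (d : nat) (s : state T) (v w : T) (q : nat) :
  core d.+1 s -> v != w -> lo s v <= q <= hi s v -> lo s w <= q <= hi s w ->
  lam s < lo s v -> lam s < lo s w -> core d (cut s v w q).
Proof.
move=> c vw vq wq lv lw.
have wv : (w == v) = false by rewrite eq_sym (negPf vw).
case: (core_dbl c) => /= H1 H2 H3 H4 H5; split=> /=.
- move=> x; have := H1 x; case: (x =P w) => [->|_]; rewrite ?wv; first lia.
  by case: eqP => [->|_]; lia.
- by move=> x; have := H2 x; case: eqP => [->|_]; lia.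
- move=> x; have := H3 x; case: (x =P w) => [->|_]; rewrite ?wv; first lia.
  by case: eqP => [->|_]; lia.
- move=> x y; move: (H4 x y).
  case: (x =P w) => [->|_]; case: (y =P w) => [->|_] // Hxy h E; lia.
- move=> p hp; have := H5 p hp.
  (* A point up to [2q] can lose only [w], a later one only [v]. *)
  set y := if p <= q.*2 then w else v => h.
  rewrite -ltnS; apply: leq_trans h _.
  rewrite -[leqRHS]addn1 -(cnt_pred1 y) /cnt -big_split /=.
  apply: leq_sum => x _; rewrite /y; case: (leqP p q.*2) => pq /=.
    by case: (x =P w) => [->|_]; rewrite ?wv; [|case: (x =P v) => [->|_]]; lia.
  by case: (x =P w) => [->|_]; rewrite ?wv; [|case: (x =P v) => [->|_]]; lia.
Qed.

(** * Effect of the moves on the counts *)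

Lemma cnt_eq1 (T : finType) (x : T) (b : bool) (P Q : pred T) :
  (forall v, v != x -> P v = Q v) -> P x + b = Q x :> nat ->
  cnt P + b = cnt Q.
Proof.
move=> H Hx; rewrite /cnt (bigD1 x) //= [in RHS](bigD1 x) //= addnAC Hx.
by congr (_ + _); apply: eq_bigr => v /H ->.
Qed.

Lemma cnt_raise (T : finType) (s : state T) (x : T)
    (s' := setlo s x (lam s).+1) :
  lo s x <= lam s < hi s x ->
  [/\ cU s' + 1 = cU s, cY s' = cY s + 1, cZ s' + (lo s x == 0) = cZ s
    & cJ s' + (lo s x != 0) = cJ s].
Proof.
move=> hx; split.
- by apply: (cnt_eq1 (b := true) (x := x)) => [v /negPf /= ->|];
    rewrite //= ?eqxx; lia.
- by apply/esym/(cnt_eq1 (b := true) (x := x)) => [v /negPf /= ->|];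
    rewrite //= ?eqxx; lia.
- by apply: (cnt_eq1 (x := x)) => [v /negPf /= ->|];
    rewrite //= ?eqxx; lia.
- by apply: (cnt_eq1 (x := x)) => [v /negPf /= ->|];
    rewrite //= ?eqxx; lia.
Qed.

Lemma cnt_clean (T : finType) (s : state T) (x : T) (s' := sethi s x (lam s)) :
  lo s x <= lam s < hi s x ->
  [/\ cU s' + 1 = cU s, cY s' = cY s, cZ s' = cZ s & cJ s' = cJ s].
Proof.
move=> hx; split => //.
- by apply: (cnt_eq1 (b := true) (x := x)) => [v /negPf /= ->|];
    rewrite //= ?eqxx; lia.
- apply: eq_bigr => v _ /=; case: (v =P x) => [->|_]; lia.
Qed.

Lemma cnt_cut_up (T : finType) (s : state T) (v w : T) (q : nat)
    (s' := cut s v w q) :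
  lam s < q -> lam s < lo s v -> lam s < lo s w -> lo s v <= hi s v ->
  [/\ cU s' = cU s, cY s' = cY s, cZ s' = cZ s & cJ s' = cJ s].
Proof.
move=> hq hv hw hv'; split; apply: eq_bigr => x _ /=.
all: case: (x =P w) => [->|_]; last case: (x =P v) => [->|_].
all: lia.
Qed.

(** The right end of [x] is [top s], so every interval of Y starts at or before it and [x] gains one
    arc to each. *)
Lemma ext_clean (T : finType) (d : nat) (s : state T) (x : T) :
  core d s -> lo s x <= lam s < hi s x -> ext s (sethi s x (lam s)) (cY s).
Proof.
move=> c hx; have px : lam s <= hi s x by lia.
have := ext_sethi px; congr (ext _ _ _); apply: eq_bigr => v _.
by have := lo_hi c v; have := hi_top c v; have := mid_top c hx; lia.
Qed.

Lemma cost_raise (T : finType) (s : state T) (x : T) :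
  cnt (fun u => lo s x <= hi s u < (lam s).+1) <= cX s.
Proof. by apply: leq_sum => v _; lia. Qed.

(* Sliding [hi s f] down within [X] adds any number of arcs up to about [cY s],
   so a ready element lets OBreaker hit the prescribed number of arcs exactly;
   [m] is [cZ] at the beginning of the round. *)
Record ready (T : finType) (m : nat) (s : state T) (f : T) : Prop := Ready {
  ready_lo : lo s f = 0;
  ready_hi : hi s f <= lam s;
  ready_cY : cY s <= cnt (fun v => 0 < lo s v <= hi s f) + 1;
  ready_cZ :
    m <= cnt (fun v => [&& v != f, lo s v == 0 & lam s <= hi s v]) + 2 }.

(** One step short of [ready]: choosing the ready vertex may use up a second element of Z, and its
    later conversion makes up for J lagging behind Y by one. *)
Definition settled (T : finType) (m : nat) (s : state T) : Prop :=
  m <= cZ s + 1 /\ cY s <= cJ s + 1.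

(** In a doubled state left ends are even and right ends odd. Moving a left end from 0 to 1 thus
    passes no right end and creates a fresh left end: [f] becomes an element of J at no cost. *)
Lemma ext_conv (T : finType) (s : state T) (f : T) :
  lo s f = 0 -> ext s (setlo (dbl s) f 1) 0.
Proof.
move=> f0; have py : lo (dbl s) f <= 1 by rewrite /= f0.
have := ext_trans (ext_dbl s) (ext_setlo py); rewrite add0n.
rewrite (_ : cnt _ = 0) // /cnt big1 // => v _ /=; lia.
Qed.

Lemma core_conv (T : finType) (d : nat) (s : state T) (f : T) :
  core d s -> lo s f = 0 -> core d (setlo (dbl s) f 1).
Proof.
by move=> c f0; apply: core_setlo (core_dbl c) _ _ _ _ => //= *; lia.
Qed.

Lemma cnt_conv (T : finType) (s : state T) (f : T) (s' := setlo (dbl s) f 1) :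
  lo s f = 0 ->
  [/\ cU s' = cU s, cY s' = cY s, cZ s' + (lam s <= hi s f) = cZ s
    & cJ s' = cJ s + 1].
Proof.
move=> f0; split.
- by apply: eq_bigr => v _ /=; case: (v =P f) => [->|_]; lia.
- by apply: eq_bigr => v _ /=; case: (v =P f) => [->|_]; lia.
- apply: (cnt_eq1 (x := f)) => [v /negPf /= ->|];
    rewrite /= ?eqxx; lia.
- apply/esym/(cnt_eq1 (x := f) (b := true)) => [v /negPf /= ->|];
    rewrite /= ?eqxx; lia.
Qed.

Lemma settle (T : finType) (d m : nat) (s : state T) :
  core d s -> 0 < cZ s -> m <= cZ s -> cY s <= cJ s + 2 ->
  exists s', [/\ ext s s' 0, core d s', cU s' = cU s, cY s' = cY s
                & settled m s'].
Proof.
move=> c /cnt_gt0[f /andP[/eqP f0 lf]] mZ YJ.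
have [E1 E2 E3 E4] := cnt_conv f0.
exists (setlo (dbl s) f 1); split=> //; first exact: ext_conv.
  exact: core_conv.
by rewrite /settled E2 E4; lia.
Qed.

(** * Responses to OMaker's arc *)

(* [C = b + 1] counts the arcs of a round, OMaker's included; [g] of them are
   left over, and [cY s'] more if no element of [U] has been used up. *)
Definition response (T : finType) (d C g : nat) (s : state T) (v w : T)
    (s' : state T) : Prop :=
  exists k (e : bool),
  [/\ ext s s' k, (v, w) \in arcs s', core d s', cU s' + e = cU s
    & k + g + ~~ e * cY s' <= C] /\ cY s <= cY s' <= cY s + 1.

Lemma cnt_pred1_and (T : finType) (x : T) (b : bool) :
  cnt (fun v => (v == x) && b) = b.
Proof.
case: b; last by rewrite /cnt big1 // => v _; rewrite andbF.
by rewrite -[RHS](cnt_pred1 x); apply: eq_bigr => v _; rewrite andbT.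
Qed.

Lemma cnt_cut_low (T : finType) (s : state T) (v w : T) (q : nat)
    (s' := cut s v w q) :
  v != w -> lo s v <= lam s -> lo s w <= lam s -> q <= lam s ->
  [/\ cU s' + (lam s < hi s v) = cU s, cY s' = cY s, cJ s <= cJ s'
    & cZ s <= cZ s' + ((lo s v == 0) && (lam s <= hi s v))
                    + ((lo s w == 0) && (lam s <= hi s w))].
Proof.
move=> vw hv hw ql; have wv : (w == v) = false by rewrite eq_sym (negPf vw).
split.
- apply: (cnt_eq1 (x := v)) => [x /negPf /= ->|]; last first.
    by rewrite /= eqxx (negPf vw); lia.
  by case: (x =P w) => [->|_]; lia.
- by apply: eq_bigr => x _ /=; case: (x =P w) => [->|_]; lia.
- by apply: leq_sum => x _ /=; case: (x =P w) => [->|_]; lia.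
- rewrite -[X in _ <= _ + X + _](cnt_pred1_and v).
  rewrite -[X in _ <= _ + X](cnt_pred1_and w).
  rewrite /cZ /cnt -!big_split; apply: leq_sum => x _ /=.
  by case: (x =P w) => [->|_]; rewrite ?wv; [|case: (x =P v) => [->|_]]; lia.
Qed.

(** As [q <= lam s], the two counted sets and Z are pairwise disjoint; if [v] ends by [lam s], Y is
    disjoint from all three. *)
Lemma cost_cut_low (T : finType) (s : state T) (v w : T) (q : nat) :
  (forall x, lo s x <= hi s x) -> q <= lam s -> q <= hi s v -> lo s w <= q ->
  (cnt (fun y => q < lo s y <= hi s v) + cnt (fun x => lo s w <= hi s x < q)).+1
   + cZ s + (hi s v <= lam s) * cY s <= #|T| + 1.
Proof.
move=> H ql qv qw; rewrite addSn addSn addn1 ltnS -cntT.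
case: (leqP (hi s v) (lam s)) => hv; rewrite ?mul1n ?mul0n ?addn0.
all: rewrite /cY /cZ /cnt -!big_split; apply: leq_sum => x _ /=; have := H x.
all: lia.
Qed.

Lemma respond_low (T : finType) (d C g : nat) (s : state T) (v w : T) :
  core d s -> overlap s v w -> lo s v <= lam s -> lo s w <= lam s ->
  (hi s w <= lam s) || (lam s < hi s v) ->
  cY s <= cJ s -> #|T| < C + d -> g + d <= cZ s ->
  exists2 s', response d C g s v w s'
    & settled (cZ s) s' \/ ready (cZ s) s' v.
Proof.
move=> c [vw ov1 ov2] lv lw hvw YJ nC gZ.
have [q [ql qv qw lvq lwq] qE] : exists2 q,
    [/\ q <= lam s, q <= hi s v, q <= hi s w, lo s v <= q & lo s w <= q]
    & lam s <= hi s v -> lam s <= hi s w -> q = lam s.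
  have Lv := lo_hi c v; have Lw := lo_hi c w.
  by exists (minn (lam s) (minn (hi s v) (hi s w))); [split|]; lia.
have [E1 E2 E3 E4] := cnt_cut_low vw lv lw ql.
have Hv : lo s v <= q <= hi s v by rewrite lvq.
have Hw : lo s w <= q <= hi s w by rewrite lwq.
exists (cut s v w q).
  do 2!eexists; split; last by rewrite E2; lia.
  split; [exact: ext_cut|exact: mem_cut|exact: core_cut_low|exact: E1|].
  have := cost_cut_low (lo_hi c) ql qv lwq; rewrite E2.
  by case: (leqP (hi s v) (lam s)) => hv; rewrite ?mul1n ?mul0n; lia.

case: (boolP [&& lo s v == 0, lam s <= hi s v, lo s w == 0
  & lam s <= hi s w]); last first.
  by move=> h; left; split; lia.
(* Only when [v] and [w] are both in Z are two elements of Z lost. The cut is then at [lam s], and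
   [v], which keeps all old left ends of J within reach, is itself ready. *)
case/and4P => /eqP v0 lamv /eqP w0 lamw; right.
have {}qE := qE lamv lamw; subst q.
have wv : (w == v) = false by rewrite eq_sym (negPf vw).
split; rewrite /= ?eqxx ?(negPf vw) ?v0 //.
  rewrite E2 addn1; apply: leq_trans YJ (leqW _); apply: leq_sum => x _ /=.
  by case: (x =P w) => [->|_]; lia.
have -> : 2 = cnt (pred1 v) + cnt (pred1 w) by rewrite !cnt_pred1.
rewrite /cZ /cnt -!big_split; apply: leq_sum => x _ /=.
by case: (x =P w) => [->|_]; rewrite ?wv; [|case: (x =P v) => [->|_]]; lia.
Qed.

Lemma respond_clean (T : finType) (d C g : nat) (s : state T) (v w : T) :
  core d s -> overlap s v w -> lo s v <= lam s < hi s v -> lam s < lo s w ->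
  cY s <= cJ s -> #|T| < C + d -> g + d <= cZ s ->
  exists2 s', response d C g s v w s' & settled (cZ s) s'.
Proof.
move=> c [vw ov1 ov2] lv lw YJ nC gZ.
have [E1 E2 E3 E4] := cnt_clean lv.
exists (sethi s v (lam s)); last by split; lia.
exists (cY s), true; split; last by lia.
split=> //; first exact: ext_clean c _.
- by rewrite inE /= eqxx.
- by apply: core_sethi => //; lia.
- by have := cXUY (lo_hi c); have := cZ_le s; lia.
Qed.

(** The raise costs at most [cX s = #|T| - cU s - cY s], and [d <= cY s] by [core_cY]. *)
Lemma respond_raise (T : finType) (d C g : nat) (s : state T) (v w : T) :
  core d s -> lo s w <= lam s < hi s w -> hi s v <= lam s ->
  #|T| < C + d -> g <= cU s ->
  response d C g s v w (setlo s w (lam s).+1).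
Proof.
move=> c hw hv nC gU.
have [E1 E2 E3 E4] := cnt_raise hw.
exists (cnt (fun u => lo s w <= hi s u < (lam s).+1)), true; split; last by lia.
split=> //; first by apply: ext_setlo; lia.
- by rewrite inE /= eqxx; lia.
- case: (core_raise c hw) => H1 H2 H3 H4 H5; split=> // p /H5; exact: ltnW.
- have := cXUY (lo_hi c); have := @cost_raise _ s w.
  have U0 : 0 < cU s by lia.
  by have := core_cY c U0; lia.
Qed.

(** Both counted sets lie in Y, since a straddling interval ends at [top s], not before [q]. They
    miss the [d] or more intervals of Y through [q]. *)
Lemma cost_cut_up (T : finType) (d : nat) (s : state T) (v w : T) (q : nat) :
  core d s -> lam s < lo s w -> lo s v <= q <= hi s v -> lam s < q ->
  cnt (fun y => q < lo s y <= hi s v) + cnt (fun x => lo s w <= hi s x < q) + d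
    <= cY s.
Proof.
move=> c hw vq ql; have qt : lam s < q <= top s by have := hi_top c v; lia.
apply: leq_trans (leq_add (leqnn _) (upper_cover c qt)) _.
rewrite /cY /cnt -!big_split; apply: leq_sum => x _ /=.
by have := lo_hi c x; have := @mid_top _ _ _ c x; lia.
Qed.

(* The cut lowers the number of intervals of [Y] covering a point by at most
   one, which raising [u] into [Y] makes up for. *)
Lemma respond_up (T : finType) (d C g : nat) (s : state T) (u v w : T)
    (s' := setlo s u (lam s).+1) :
  core d s -> lo s u <= lam s < hi s u -> overlap s' v w ->
  lam s < lo s' v -> lam s < lo s' w -> #|T| < C + d -> g <= cU s ->
  exists2 q, response d C g s v w (cut s' v w q)
    & cZ (cut s' v w q) + (lo s u == 0) = cZ s /\
      cJ (cut s' v w q) + (lo s u != 0) = cJ s.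
Proof.
move=> c hu [vw ov1 ov2] hv hw nC gU.
have c' : core d.+1 s' := core_raise c hu.
have [E1 E2 E3 E4] := cnt_raise hu; rewrite -/s' in E1 E2 E3 E4.
have [q [vq wq ql]] : exists q, [/\ lo s' v <= q <= hi s' v,
    lo s' w <= q <= hi s' w & lam s < q].
  have := lo_hi c' v; have := lo_hi c' w => ? ?.
  by exists (maxn (lo s' v) (lo s' w)); split; lia.
have vq' : lo s' v <= hi s' v by lia.
have [F1 F2 F3 F4] := @cnt_cut_up _ s' v w q ql hv hw vq'.
exists q; last by rewrite F3 F4.
set k := (cnt (fun y => q < lo s' y <= hi s' v)
  + cnt (fun x => lo s' w <= hi s' x < q)).+1.
exists (cnt (fun x => lo s u <= hi s x < (lam s).+1) + k), true.
split; last by lia.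
split.
- by apply: (ext_trans (ext_setlo _)) (ext_cut _ _ _) => //; lia.
- exact: mem_cut.
- exact: core_cut_up.
- by lia.
- have := cXUY (lo_hi c); have := @cost_raise _ s u.
  have := cost_cut_up c' hw vq ql; rewrite /k; lia.
Qed.

(** A raise into Y takes its vertex from Z ([b] true) or from J. In the second case J may be two
    behind Y, and [settle] converts one element of Z. *)
Lemma response_settle (T : finType) (d C g : nat) (s s' : state T) (v w : T)
    (b : bool) :
  response d C g s v w s' -> 0 < d -> d <= cZ s -> cY s <= cJ s ->
  cZ s' + b = cZ s -> cJ s' + ~~ b = cJ s ->
  exists2 s2, response d C g s v w s2 & settled (cZ s) s2.
Proof.
case=> k [e] [[E a c U K] Y] d0 dZ YJ Zb Jb.
case: b Zb Jb => /= Zb Jb.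
  by exists s'; [exists k, e|split; lia].
have [|||s2 [E2 c2 U2 Y2 S2]] := @settle _ d (cZ s) s' c; try lia.
exists s2 => //; exists k, e; split; last by rewrite Y2.
split; rewrite ?U2 ?Y2 //; first by have := ext_trans E E2; rewrite addn0.
by apply: (subsetP E2.1).
Qed.

(** If [v] and [w] both start by [lam], they are cut there or below, or [w] is raised past [v]. If
    only [w] starts later, [v] is moved left. If only [v] does, [w] is raised and both are cut
    within Y; if both do, any straddling vertex is raised to restore the cover. *)
Lemma respond (T : finType) (d C g : nat) (s : state T) (v w : T) :
  core d s -> 0 < cU s -> overlap s v w -> cY s <= cJ s -> 0 < d ->
  #|T| < C + d -> g <= cU s -> g + d <= cZ s ->
  exists2 s', response d C g s v w s'
    & settled (cZ s) s' \/ exists f, ready (cZ s) s' f.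
Proof.
move=> c U0 ov YJ d0 nC gU gZ; have [vw ov1 ov2] := ov.
have dZ : d <= cZ s by lia.
have lift s2 : response d C g s v w s2 /\ settled (cZ s) s2 ->
  exists2 s', response d C g s v w s'
    & settled (cZ s) s' \/ exists f, ready (cZ s) s' f.
  by case=> ? ?; exists s2; [|left].
case: (leqP (lo s v) (lam s)) => lv; case: (leqP (lo s w) (lam s)) => lw.
- case: (boolP ((hi s w <= lam s) || (lam s < hi s v))) => hvw.
    have [s' R [S|S]] := respond_low c ov lv lw hvw YJ nC gZ.
      by exists s'; [|left].
    by exists s'; [|right; exists v].
  have hw : lo s w <= lam s < hi s w by lia.
  have hv : hi s v <= lam s by lia.
  have [_ _ E3 E4] := cnt_raise hw.
  have [s' ? ?] := response_settle (respond_raise c hw hv nC gU) d0 dZ YJ E3 E4.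
  exact: (lift s').
- have hv : lo s v <= lam s < hi s v by lia.
  have [s' ? ?] := respond_clean c ov hv lw YJ nC gZ; exact: (lift s').
- have hw : lo s w <= lam s < hi s w by lia.
  have [|||q R [E3 E4]] := @respond_up _ d C g s w v w c hw _ _ _ nC gU.
  + by split=> //=; rewrite ?eqxx ?(negPf vw); have := lo_hi c v; lia.
  + by rewrite /= (negPf vw).
  + by rewrite /= eqxx.
  have [s' ? ?] := response_settle R d0 dZ YJ E3 E4; exact: (lift s').
- have [u hu] := cnt_gt0 U0.
  have uv : (v == u) = false by apply/eqP => E; move: lv; rewrite E; lia.
  have uw : (w == u) = false by apply/eqP => E; move: lw; rewrite E; lia.
  have [|||q R [E3 E4]] := @respond_up _ d C g s u v w c hu _ _ _ nC gU.
  + by split=> //=; rewrite ?uv ?uw.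
  + by rewrite /= uv.
  + by rewrite /= uw.
  have [s' ? ?] := response_settle R d0 dZ YJ E3 E4; exact: (lift s').
Qed.

(** * Completing a round *)

Lemma discrete_ivt (h : nat -> nat) (N W : nat) :
  (forall p, h p <= h p.+1 + 1) -> h N <= W <= h 0 ->
  exists2 p, p <= N & h p = W.
Proof.
move=> hh; elim: N => [|N IH] hW; first by exists 0 => //; lia.
case: (leqP (h N) W) => hN.
  by have [|p pN <-] := IH; [lia|exists p => //; lia].
by exists N.+1 => //; have := hh N; lia.
Qed.

Lemma ready_exact (T : finType) (m : nat) (s : state T) (f : T) :
  settled m s -> lo s f = 0 -> hi s f = lam s -> ready m s f.
Proof.
move=> [mZ YJ] f0 fl; split=> //; rewrite ?fl //.
have E : cnt (fun v => [&& v != f, lo s v == 0 & lam s <= hi s v]) + true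
  = cZ s.
  apply: (cnt_eq1 (x := f)) => [v /negPf ->|] //=; rewrite eqxx f0 fl /=; lia.
by rewrite -E in mZ; lia.
Qed.

(** An element of Z ending exactly at [lam s] is ready. If there is none, all of Z straddles, so
    [cU s < cZ s] fails and [L] pays for moving one element to the left. *)
Lemma make_ready (T : finType) (d m L : nat) (s : state T) :
  core d s -> settled m s -> 0 < cZ s -> cU s < cZ s \/ cY s <= L ->
  exists s' (b : bool),
  [/\ ext s s' (b * cY s), core d s', cU s' + b = cU s, cY s' = cY s
    & exists f, ready m s' f] /\ (b -> cY s <= L).
Proof.
move=> c S Z0 UZ.
case: (pickP (fun f => (lo s f == 0) && (hi s f == lam s))) => [f|nf].
  case/andP=> /eqP f0 /eqP fl; exists s, false; split=> //.
  split=> //; [exact: ext_refl|by rewrite addn0|].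
  by exists f; apply: ready_exact.
have [f /andP[/eqP f0 lf]] := cnt_gt0 Z0.
have hf : lo s f <= lam s < hi s f by have := nf f; rewrite f0 eqxx /=; lia.
exists (sethi s f (lam s)), true.
have [E1 E2 E3 E4] := cnt_clean hf.
split.
  rewrite mul1n; split=> //; first exact: ext_clean c hf.
    by apply: core_sethi => //; lia.
  exists f; apply: ready_exact; rewrite /= ?eqxx //.
  by case: S => S1 S2; split; lia.
move=> _; case: UZ => // /cnt_lt[v /andP[/eqP v0 lv] nU].
by have := nf v; have := lo_hi c v; rewrite v0 eqxx /= in nU *; lia.
Qed.

(** By [lo_inj], lowering the right end of [f] by one adds at most one arc, so [discrete_ivt]
    reaches every total below [cY s]. Then [f] is converted to replenish J. *)
Lemma close_round (T : finType) (d m W : nat) (s : state T) (f : T) :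
  core d s -> ready m s f -> W < cY s ->
  exists s', [/\ ext s s' W, core d s', cU s' = cU s, cY s' = cY s
    & cY s' <= cJ s' /\ m <= cZ s' + 2].
Proof.
move=> c [f0 fl YJ mZ] WY.
have [p pf hp] : exists2 p, p <= hi s f
    & cnt (fun v => p < lo s v <= hi s f) = W.
  apply: discrete_ivt => [p|]; last first.
    by rewrite {1}/cnt big1 => [|v _]; lia.
  case: (pickP (fun v => lo s v == p.+1)) => [x /eqP xp|np].
    rewrite -(cnt_pred1 x) /cnt -big_split; apply: leq_sum => v _ /=.
    case: (v =P x) => [->|nx]; first lia.
    have : (lo s v == p.+1) && (lo s v <= hi s f) = false; last lia.
    by apply/negP => /andP[/eqP vp vf]; apply/nx/esym/(lo_inj c); lia.
  rewrite -[leqLHS]addn0; apply: leq_add => //; apply: leq_sum => v _.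
  by have := np v; lia.
pose s1 := sethi s f p.
have c1 : core d s1 by apply: core_sethi => //; rewrite f0; lia.
have f1 : lo s1 f = 0 by [].
have [E1 E2 E3 E4] := cnt_conv f1.
exists (setlo (dbl s1) f 1); split.
- have := ext_trans (ext_sethi pf) (ext_conv f1); by rewrite addn0 hp.
- exact: core_conv.
- by rewrite E1; apply: eq_bigr => v _ /=; case: eqP => [->|_]; lia.
- by rewrite E2.
- rewrite E2 E4; split.
    apply: leq_trans YJ _; rewrite leq_add2r; apply: leq_sum => v _ /=; lia.
  apply: leq_trans mZ _; rewrite leq_add2r; apply: leq_sum => v _ /=.
  by case: eqP => _ /=; lia.
Qed.

Lemma ready_clean (T : finType) (m : nat) (s : state T) (f u : T) :
  ready m s f -> lo s u <= lam s < hi s u -> ready m (sethi s u (lam s)) f.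
Proof.
move=> [f0 fl YJ mZ] hu.
have fu : (f == u) = false by apply/eqP => E; move: hu; rewrite -E; lia.
split=> //=; rewrite ?fu //; apply: leq_trans mZ _.
rewrite leq_add2r; apply: leq_sum => v _ /=; case: (v =P u) => [->|_]; lia.
Qed.

(** Division of [L] by [cY s]: each unit of the quotient moves a straddling vertex left, and
    [close_round] spends the remainder, unless the straddling vertices run out first. *)
Lemma fill (T : finType) (d m L : nat) (s : state T) (f : T) :
  core d s -> ready m s f ->
  (exists s' k, [/\ ext s s' L, core d s', cU s' + k = cU s /\ 0 < cU s',
      cY s' = cY s /\ L < k.+1 * cY s & cY s' <= cJ s' /\ m <= cZ s' + 2])
  \/ (exists s' j, [/\ ext s s' j, j <= L, core d s', cU s' = 0
      & cY s' = cY s]).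
Proof.
move: {2}(cU s) (leqnn (cU s)) => N; elim: N L s => [|N IH] L s UN c R.
  by right; exists s, 0; split=> //; [exact: ext_refl|lia].
case: (posnP (cU s)) => U0.
  by right; exists s, 0; split=> //; exact: ext_refl.
case: (ltnP L (cY s)) => LY.
  have [s' [E c' EU EY [YJ mZ]]] := close_round c R LY.
  by left; exists s', 0; split=> //; rewrite ?mul1n ?EU ?addn0.
have [u hu] := cnt_gt0 U0; have [E1 E2 E3 E4] := cnt_clean hu.
have E0 := ext_clean c hu.
have c1 : core d (sethi s u (lam s)) by apply: core_sethi => //; lia.
have [|[s' [k [E c' [EU U0'] [EY Lk] H]]]|[s' [j [E jL c' EU EY]]]] :=
  IH (L - cY s) _ _ c1 (ready_clean R hu); first by lia.
- left; exists s', k.+1; split=> //.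
  + by have := ext_trans E0 E; rewrite subnKC.
  + by lia.
  + by split; [rewrite EY|rewrite mulSn; rewrite E2 in Lk; lia].
- right; exists s', (cY s + j); split=> //; [exact: ext_trans E0 E|lia].
Qed.

(** * The final phase *)

Record split_state (T : finType) (C : nat) (s : state T) : Prop := Fin {
  fin_lo_hi : forall v, lo s v <= hi s v;
  fin_sep : forall v, (hi s v <= lam s) || (lam s < lo s v);
  fin_cX : cX s <= C;
  fin_cY : cY s <= C }.

Definition saturated (T : finType) (s : state T) : Prop :=
  forall v w, ~ overlap s v w.

Lemma fin_cut (T : finType) (C : nat) (s : state T) (v w : T) (q : nat) :
  split_state C s -> v != w -> lo s v <= q <= hi s v -> lo s w <= q <= hi s w ->
  split_state C (cut s v w q).
Proof.
case=> H1 H2 HX HY vw vq wq; have := H2 v; have := H2 w => Sv Sw.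
have wv : (w == v) = false by rewrite eq_sym (negPf vw).
split=> /=.
- move=> x; have := H1 x; case: (x =P w) => [->|_]; rewrite ?wv; first lia.
  by case: (x =P v) => [->|_]; lia.
- move=> x; have := H2 x; case: (x =P w) => [->|_]; rewrite ?wv; first lia.
  by case: (x =P v) => [->|_]; lia.
- apply: leq_trans HX; apply: leq_sum => x _ /=.
  by case: (x =P v) => [->|_]; lia.
- apply: leq_trans HY; apply: leq_sum => x _ /=.
  by case: (x =P w) => [->|_]; lia.
Qed.

(** [v] and [w] share a side. Both counted sets lie in it, are disjoint and omit [v], which pays for
    the extra one. *)
Lemma cost_fin_cut (T : finType) (C : nat) (s : state T) (v w : T) (q : nat) :
  split_state C s -> lo s v <= q <= hi s v -> lo s w <= q <= hi s w ->
  (cnt (fun y => q < lo s y <= hi s v)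
   + cnt (fun x => lo s w <= hi s x < q)).+1 <= C.
Proof.
case=> H1 H2 HX HY vq wq; have := H2 v; have := H2 w => Sv Sw.
rewrite -addn1 -(cnt_pred1 v).
case/orP: Sw => Sv'; [apply: leq_trans HX|apply: leq_trans HY].
all: rewrite /cX /cY /cnt -!big_split; apply: leq_sum => x _ /=.
all: by have := H1 x; have := H2 x; case: (x =P v) => [->|_]; lia.
Qed.

(** Among overlapping pairs with [w] starting inside [v], take [lo s w] maximal. Then no other
    interval starts in [v] after [lo s w], so cutting there adds only the arc from [v] to [w]. *)
Lemma fin_step (T : finType) (C : nat) (s : state T) :
  split_state C s -> saturated s \/ exists2 s', split_state C s' & ext s s' 1.
Proof.
move=> F; have H1 := fin_lo_hi F.
pose P (p : T * T) := (p.1 != p.2) && (lo s p.1 <= lo s p.2 <= hi s p.1).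
case: (pickP P) => [p0 Pp0|nP]; last first.
  left=> v w [vw h1 h2]; have := nP (v, w); have := nP (w, v).
  by rewrite /P /= [w == v]eq_sym vw; lia.
right; case: (arg_maxnP (fun p => lo s p.2) Pp0) => -[v w].
rewrite {1}/P /= => /andP[vw hvw] M.
have vq : lo s v <= lo s w <= hi s v by [].
have wq : lo s w <= lo s w <= hi s w by rewrite leqnn H1.
exists (cut s v w (lo s w)); first exact: fin_cut.
have A0 : cnt (fun y => lo s w < lo s y <= hi s v) = 0.
  apply: big1 => x _; case E: (_ < _ <= _) => //.
  have xv : v != x by apply/eqP => xv; move: E; rewrite -xv; lia.
  by have := M (v, x); rewrite /P /= xv /=; lia.
have B0 : cnt (fun x => lo s w <= hi s x < lo s w) = 0.
  by apply: big1 => x _; lia.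
by have := ext_cut vw vq wq; rewrite A0 B0.
Qed.

Lemma fin_fill (T : finType) (C m : nat) (s : state T) :
  split_state C s -> exists s' j,
  [/\ split_state C s', ext s s' j, j <= m & j = m \/ saturated s'].
Proof.
elim: m s => [|m IH] s F.
  by exists s, 0; split=> //; [exact: ext_refl|left].
case: (fin_step F) => [tot|[s1 F1 E1]].
  by exists s, 0; split=> //; [exact: ext_refl|right].
have [s' [j [F' E' jm H]]] := IH s1 F1.
exists s', (1 + j); split=> //; first exact: ext_trans E1 E'.
by case: H => [->|]; [left|right].
Qed.

Lemma fin_round (T : finType) (C : nat) (s : state T) (v w : T) :
  split_state C s -> overlap s v w ->
  exists s' j, [/\ split_state C s', (v, w) \in arcs s', ext s s' j, j <= C
    & j = C \/ saturated s'].
Proof.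
move=> F [vw h1 h2]; have H1 := fin_lo_hi F.
have := H1 v; have := H1 w => Hw Hv.
have vq : lo s v <= maxn (lo s v) (lo s w) <= hi s v by lia.
have wq : lo s w <= maxn (lo s v) (lo s w) <= hi s w by lia.
set q := maxn _ _ in vq wq.
have E := ext_cut vw vq wq; have cost := cost_fin_cut F vq wq.
set k := (_ + _).+1 in E cost.
have [s' [j [F' E' jm H]]] := fin_fill (C - k) (fin_cut F vw vq wq).
exists s', (k + j); split=> //.
- exact: (subsetP E'.1 _ (mem_cut s q vw)).
- exact: ext_trans E E'.
- by lia.
- by case: H => [->|]; [left; lia|right].
Qed.

(** * The number of straddling vertices *)

(* Constraints on [u = cU s] after [i] rounds, in chronological order.  In the
   first regime each round moves at least ten elements of [U] to [X]; in the
   second one [u * (d + i)] does not increase; in the third one it suffices that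
   each round uses up one element of [U]. *)
Definition regime (n d i u : nat) : Prop :=
  [\/ (u + 10 * i + d <= n) && (4 * n <= 5 * u),
      [&& 5 * u <= 4 * n, 1000 * (u * (d + i)) <= 53 * (n * n)
        & 50 * i <= 9 * n]
    | 100 * (u + i) <= 42 * n].

Lemma bound_early (n d i u : nat) :
  2500 <= n -> n < 20 * d <= n + 20 -> u + 10 * i + d <= n -> 4 * n <= 5 * u ->
  forall u' k, u' + k = u -> (4 * n) %/ 5 < k * (d + i + 1) ->
  regime n d i.+1 u'.
Proof.
move=> n0 nd h1 h2 u' k uk hk.
have k10 : 10 <= k.
  rewrite leqNgt; apply/negP => k9.
  have := leq_trans hk (leq_mul (k9 : k <= 9) (leqnn (d + i + 1))); lia.
case: (leqP (4 * n) (5 * u')) => h4.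
  by apply: Or31; lia.
apply: Or32; rewrite (ltnW h4) /=; apply/andP; split; last by lia.
(* Entry to the second regime: 0.8 * 0.065 = 0.052 leaves room below 0.053. *)
have h5 : 200 * (d + i.+1) <= 13 * n + 600 by lia.
have := leq_mul (ltnW h4) h5; have := leq_mul n0 (leqnn n); lia.
Qed.

Lemma bound_mid (n d i u : nat) :
  2500 <= n -> n < 20 * d <= n + 20 ->
  5 * u <= 4 * n -> 1000 * (u * (d + i)) <= 53 * (n * n) -> 50 * i <= 9 * n ->
  u + 3 * d + 2 * i <= n /\
  forall u' k, u' + k = u -> u < k * (d + i + 1) -> regime n d i.+1 u'.
Proof.
move=> n0 nd h1 h2 h3; have nn := leq_mul n0 (leqnn n); split.
  case: (leqP (50 * i) n) => hi; first by lia.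
  rewrite leqNgt; apply/negP => h4.
  (* If the claim failed, [u] would exceed about [17n/20 - 2i]. The product of this bound with
     [d + i] is concave in [i]; using [(50i - n)(9n - 50i) >= 0] ([h10]), it exceeds
     [53n^2/1000]. *)
  have h5 : 17 * n <= 20 * u + 40 * i + 60 by lia.
  have {}h5 := leq_mul h5 (leqnn (d + i)).
  have h7 : n * n <= n * (20 * d) by apply: leq_mul => //; lia.
  have h8 : i * (20 * d) <= i * (n + 20) by apply: leq_mul => //; lia.
  have h9 : n * n <= n * (50 * i) by apply: leq_mul => //; lia.
  have h10 : (50 * i - n) * (50 * i) <= (50 * i - n) * (9 * n).
    by apply: leq_mul => //; lia.
  have {}h10 : 50 * i * (50 * i) + n * (9 * n)
      <= n * (50 * i) + 50 * i * (9 * n).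
    have := leq_mul (ltnW hi) (leqnn (9 * n)).
    by move: h10; rewrite !mulnBl; lia.
  by lia.
move=> u' k uk hk.
(* [u' * (d + i + 1)] equals [u * (d + i) + u - k * (d + i + 1)], which is below [u * (d + i)]. *)
have h4 : 1000 * (u' * (d + i.+1)) <= 53 * (n * n).
  by apply: leq_trans h2; rewrite leq_mul2l /=; nia.
case: (leqP (50 * i.+1) (9 * n)) => h5; first by apply: Or32; rewrite h4; lia.
(* Now [u'] is at most 53n/230, and 53/230 + 0.18 is about 0.411, below 0.42. *)
apply: Or33; have h6 : 23 * n <= 100 * (d + i.+1) by lia.
have := leq_mul (leqnn u') h6 => h7.
have : 230 * u' <= 53 * n; last by lia.
rewrite -(@leq_pmul2r n); last by lia.
by lia.
Qed.

(** [g] is the leftover asked of [respond], and the disjunction feeds [make_ready]. In the first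
    regime [u + d] may exceed [z], so [g] is taken as 4n/5 rounded down instead of [u]. *)
Lemma bound_gap (n d i u z : nat) :
  2500 <= n -> n < 20 * d <= n + 20 -> regime n d i u ->
  n <= z + 2 * d + 2 * i ->
  exists g, [/\ g <= u, g + d <= z, u + 2 <= z \/ d + i + 1 <= g
    & forall u' k, u' + k = u -> g < k * (d + i + 1) -> regime n d i.+1 u'].
Proof.
move=> n0 nd [/andP[h1 h2]|/and3P[h1 h2 h3]|h1] nz.
- exists ((4 * n) %/ 5); split; try lia; exact: bound_early.
- have [h4 h5] := bound_mid n0 nd h1 h2 h3.
  by exists u; split=> //; lia.
- exists u; split=> //; try lia; move=> u' k uk hk; apply: Or33.
  by case: k uk hk => // k; lia.
Qed.

(** * The invariant kept from round to round *)

Record main_state (T : finType) (d i : nat) (s : state T) : Prop := Main {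
  main_core : core d s;
  main_cU : 0 < cU s;
  main_cYJ : cY s <= cJ s;
  main_cY : cY s <= d + i;
  main_cZ : #|T| <= cZ s + 2 * d + 2 * i;
  main_bound : regime #|T| d i (cU s) }.

Definition good_state (T : finType) (C d : nat) (s : state T) : Prop :=
  split_state C s \/ exists i, main_state d i s.

Lemma core_fin (T : finType) (C d : nat) (s : state T) :
  core d s -> cU s = 0 -> d <= cY s <= C -> #|T| <= C + d -> split_state C s.
Proof.
move=> c U0 Y nC; split; try lia; first exact: lo_hi c.
- move=> v; move/eqP: U0; rewrite sum_nat_eq0 => /forallP/(_ v) /=; lia.
- by have := cXUY (lo_hi c); lia.
Qed.

Lemma main_state_round (T : finType) (C d i : nat) (s : state T) (v w : T) :
  2500 <= #|T| -> #|T| < 20 * d <= #|T| + 20 -> #|T| < C + d ->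
  main_state d i s -> overlap s v w ->
  exists s' j, [/\ (v, w) \in arcs s', ext s s' j, j <= C,
    j = C \/ saturated s' & good_state C d s'].
Proof.
move=> n0 nd nC [c U0 YJ Yd nZ B] ov.
have [g [gU gZ hg next]] := bound_gap n0 nd B nZ.
have d2 : 2 <= d by lia.
have dY := core_cY c U0.
have XUY := cXUY (lo_hi c); have ZXU := cZ_le s.
have [s1 [k [e [[E1 a1 c1 U1 k1] Y1]]] S1] :=
  @respond _ d C g s v w c U0 ov YJ (ltnW d2) nC gU gZ.
have [s2 [b [[E2 c2 U2 Y2 [f R2]] bL]]] : exists s2 (b : bool),
  [/\ ext s1 s2 (b * cY s1), core d s2, cU s2 + b = cU s1, cY s2 = cY s1
    & exists f, ready (cZ s) s2 f] /\ (b -> cY s1 <= C - k).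
  case: S1 => [S1|[f R1]]; last first.
    exists s1, false; split=> //; split=> //; rewrite ?addn0 //.
      exact: ext_refl.
    by exists f.
  have [S2 S3] := S1.
  by apply: make_ready => //; lia.
have E12 := ext_trans E1 E2.
have bC : k + b * cY s1 <= C by case: b bL {U2 E2 E12} => [/(_ isT)|]; lia.
have a2 := subsetP E2.1 _ a1.
case: (fill (C - (k + b * cY s1)) c2 R2).
  move=> [s3 [m [E3 c3 [U3 U3'] [Y3 Lm] [YJ3 Z3]]]].
  exists s3, C; split=> //.
  - exact: (subsetP E3.1).
  - by have := ext_trans E12 E3; rewrite subnKC.
  - by left.
  right; exists i.+1; split=> //; try lia.
  (* [fill], [make_ready] and the response use up [m], [b] and [e] straddling vertices. If [e] is 0,
     the response leaves a further [cY s1]; either way [g < (m + b + e) * cY s1]. *)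
  apply: (next _ (m + b + e)); first by lia.
  apply: leq_trans (_ : (m + b + e) * cY s1 <= _); last first.
    by rewrite leq_mul2l; lia.
  rewrite Y2 in Lm; case: e {U1} k1 => /=; rewrite ?mul0n ?mul1n => k1.
    rewrite !mulnDl; rewrite mulSn in Lm; lia.
  rewrite !mulnDl; rewrite mulSn in Lm; lia.
move=> [s3 [m [E3 mL c3 U3 Y3]]].
have F3 : split_state C s3 by apply: core_fin c3 _ _ _; lia.
have [s4 [j [F4 E4 jL H4]]] := fin_fill (C - (k + b * cY s1) - m) F3.
exists s4, (k + b * cY s1 + m + j); split.
- by apply: (subsetP E4.1); apply: (subsetP E3.1).
- exact: ext_trans (ext_trans E12 E3) E4.
- by lia.
- by case: H4 => [->|]; [left; lia|right].
- by left.
Qed.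

Lemma good_state_round (T : finType) (C d : nat) (s : state T) (v w : T) :
  2500 <= #|T| -> #|T| < 20 * d <= #|T| + 20 -> #|T| < C + d ->
  good_state C d s -> overlap s v w ->
  exists s' j, [/\ (v, w) \in arcs s', ext s s' j, j <= C,
    j = C \/ saturated s' & good_state C d s'].
Proof.
move=> n0 nd nC [F|[i M]] ov; last exact: main_state_round M ov.
have [s' [j [F' a E jC H]]] := fin_round F ov.
by exists s', j; split=> //; left.
Qed.

Lemma good_state_lo_hi (T : finType) (C d : nat) (s : state T) :
  good_state C d s -> forall v, lo s v <= hi s v.
Proof. by case=> [/fin_lo_hi|[i /main_core/lo_hi]]. Qed.

(** * The game *)

Lemma edge_pair (n : nat) (v w : 'I_n) : edge (v, w) = edge (w, v).
Proof. by rewrite /edge setUC. Qed.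

Lemma arcs_edge_inj (n : nat) (s : state 'I_n) :
  (forall v, lo s v <= hi s v) -> {in arcs s &, injective (@edge n)}.
Proof.
move=> H a c; rewrite !inE => ha hc /edgeP[//|E].
exfalso; move: ha hc (H c.1) (H c.2); rewrite E /=; clear; lia.
Qed.

Lemma undirected_overlap (n : nat) (s : state 'I_n) (a : Defs.arc n) :
  (forall v, lo s v <= hi s v) ->
  edge a \in undirected (arcs s) <-> overlap s a.1 a.2.
Proof.
move=> H; rewrite inE inE cards2 eqSS eqb1; split.
  case/andP=> na vw; split=> //.
    rewrite leqNgt; apply: contra na => h; apply/imsetP.
    by exists (a.2, a.1); rewrite ?inE // edge_pair -surjective_pairing.
  by rewrite leqNgt; apply: contra na => h; apply: imset_f; rewrite inE.
case: a => v w [vw h1 h2]; rewrite vw andbT; apply/imsetP => -[[x y]].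
by rewrite inE /= in h1 h2 * => hc /edgeP[] [E1 E2]; subst; lia.
Qed.

Lemma legal_move_diff (n k j : nat) (D D' : position n) :
  D \subset D' -> {in D' &, injective (@edge n)} ->
  [set edge a | a in D'] \subset complete_edges n ->
  #|D'| = #|D| + j -> j <= k -> j = k \/ undirected D' = set0 ->
  legal_move k D (D' :\: D).
Proof.
move=> DD' inj cpl cD jk H.
have inj' : {in D' :\: D &, injective (@edge n)}.
  by move=> a c /setDP[? _] /setDP[? _]; apply: inj.
have cS : #|D' :\: D| = j.
  by rewrite cardsD (setIidPr DD') cD addKn.
have sub : [set edge a | a in D' :\: D] \subset undirected D.
  apply/subsetP => _ /imsetP[a /setDP[aD' aD] ->].
  apply/setDP; split; first by apply: (subsetP cpl); apply: imset_f.
  apply/imsetP => -[c cD0 E].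
  by move: aD; rewrite (inj _ _ aD' (subsetP DD' _ cD0) E) cD0.
split=> //; rewrite cS.
have le := subset_leq_card sub; rewrite card_in_imset // cS in le.
case: H => [<-|U0]; first by apply/esym/minn_idPl.
have sub' : undirected D \subset [set edge a | a in D' :\: D].
  apply/subsetP => x; rewrite inE => /andP[nx cx].
  have : x \notin undirected D' by rewrite U0 inE.
  rewrite inE cx andbT negbK => /imsetP[a aD' xa]; rewrite xa.
  apply: imset_f; apply/setDP; split=> //.
  by apply: contra nx => aD; rewrite xa imset_f.
have := subset_leq_card sub'; rewrite card_in_imset // cS => le'.
have -> : #|undirected D| = j by apply/eqP; rewrite eqn_leq le le'.
by rewrite (minn_idPr jk).
Qed.

(** OBreaker plays the arcs of [s'] missing after OMaker's arc, which is one of the [j] new ones.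
    Arcs accumulate, so the play ends, and [hi s] increases along arcs, which excludes a directed
    cycle. *)
Lemma good_state_not_winning (n b d : nat) (f : strategy n) :
  2500 <= n -> n < 20 * d <= n + 20 -> n < b.+1 + d ->
  winning_strategy b f ->
  forall (s : state 'I_n) h, good_state b.+1 d s -> ~ history b f (arcs s :: h).
Proof.
move=> n0 nd nb W s h; have [N] := ubnP (#|[set: 'I_n * 'I_n]| - #|arcs s|).
elim: N s h => // N IH s h sN G hist.
have H := good_state_lo_hi G; have := W _ _ hist.
case: eqP => [_|/eqP U0].
  apply: (dicycle_rank (r := hi s)) => u v; rewrite inE /= => uv.
  exact: leq_trans (H v).
set a := f _ => -[aU _ _].
have {}aU : edge a \in undirected (arcs s).
  by move: aU; rewrite imset_set1 sub1set.
have [s' [j [a' E jC H' G']]] : exists s' j, [/\ a \in arcs s', ext s s' j,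
    j <= b.+1, j = b.+1 \/ saturated s' & good_state b.+1 d s'].
  have /undirected_overlap ov := aU; rewrite [a]surjective_pairing.
  by apply: good_state_round; rewrite ?card_ord //; apply: ov.
have as_ : a \notin arcs s.
  move: aU; rewrite inE => /andP[aU _]; apply: contra aU; exact: imset_f.
have [E1 E2] := E; have H1 := good_state_lo_hi G'.
have sub : a |: arcs s \subset arcs s' by rewrite subUset sub1set a'.
have c1 : #|a |: arcs s| = #|arcs s|.+1 by rewrite cardsU1 as_.
have j0 : 0 < j.
  by have := subset_leq_card sub; rewrite c1 E2 -addn1 leq_add2l.
have L : legal_move b (a |: arcs s) (arcs s' :\: (a |: arcs s)).
  apply: (@legal_move_diff _ _ j.-1) => //.
  - exact: arcs_edge_inj.
  - apply/subsetP => _ /imsetP[c + ->]; rewrite !inE cards2 => hc.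
    have -> // : c.1 != c.2.
    by apply/eqP => Ec; move: hc; rewrite Ec; have := H1 c.2; lia.
  - by rewrite c1 E2 addSnnS prednK.
  - by lia.
  - case: H' => [->|tot]; [by left|right].
    apply/setP => e; rewrite [RHS]inE; apply/negP => he.
    have : #|e| == 2 by move: he; rewrite !inE => /andP[].
    case/cards2P => x [y [xy Ee]]; move: he; rewrite Ee => he.
    by apply: (tot x y); apply/(@undirected_overlap _ _ (x, y)).
have := history_round hist U0 L; rewrite -/a.
rewrite (_ : (a |: arcs s) :|: _ = arcs s'); last first.
  by rewrite -{1}(setIidPr sub) setID.
apply: IH => //.
have le := subset_leq_card (subsetT (arcs s')).
have lt : #|arcs s| < #|arcs s'| by rewrite E2 -[ltnLHS]addn0 ltn_add2l.
exact: leq_trans (ltn_sub2l (leq_trans lt le) lt) sN.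
Qed.

(* The first [d] vertices form [Y] and the next [d] have distinct left ends. *)
Definition start_state (n d : nat) : state 'I_n :=
  State (fun v : 'I_n =>
           if v < d then d.+1 else if v < 2 * d then (v - d).+1 else 0)
        (fun=> d.+1) d d.+1.

Lemma cnt_ltn (n m : nat) : m <= n -> cnt (fun v : 'I_n => v < m) = m.
Proof.
move=> mn; rewrite /cnt -(big_mkord xpredT (fun v => (v < m : nat))) /=.
rewrite (big_cat_nat (n := m)) //= big_nat (eq_bigr (fun=> 1)); last by lia.
rewrite [X in _ + X]big_nat [X in _ + X]big1 => [|v]; last by lia.
by rewrite -big_nat sum_nat_const_nat; lia.
Qed.

Lemma start_main_state (n d : nat) :
  2500 <= n -> n < 20 * d <= n + 20 -> main_state d 0 (start_state n d).
Proof.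
move=> n0 nd.
have c1 : cnt (fun v : 'I_n => v < d) = d by apply: cnt_ltn; lia.
have c2 : cnt (fun v : 'I_n => v < 2 * d) = 2 * d by apply: cnt_ltn; lia.
have cn : cnt (@predT 'I_n) = n by rewrite cntT card_ord.
have EU : cU (start_state n d) + d = n.
  rewrite -[in X in _ + X]c1 -[RHS]cn /cnt -big_split /=; apply: eq_bigr => v _.
  by case: ifP; [|case: ifP]; lia.
have EY : cY (start_state n d) = d.
  rewrite -[RHS]c1; apply: eq_bigr => v _ /=.
  by case: ifP; [|case: ifP]; lia.
have EJ : cJ (start_state n d) + d = 2 * d.
  rewrite -[in X in _ + X]c1 -[RHS]c2 /cnt -big_split /=; apply: eq_bigr => v _.
  by case: ifP; [|case: ifP]; lia.
have EZ : cZ (start_state n d) + 2 * d = n.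
  rewrite -[in X in _ + X]c2 -[RHS]cn /cnt -big_split /=; apply: eq_bigr => v _.
  by case: ifP; [|case: ifP]; lia.
split; rewrite ?card_ord; try lia; last by apply: Or31; lia.
split=> /=.
- by move=> v; case: ifP; [|case: ifP]; lia.
- by [].
- by [].
- move=> u v h E; apply: val_inj => /=; move: h E.
  by do 2!(case: ifP; [|case: ifP]); lia.
- move=> p hp; rewrite -[leqLHS]c1; apply: leq_sum => v _ /=.
  by case: ifP; lia.
Qed.

Lemma arcs_start (n d : nat) : arcs (start_state n d) = set0.
Proof.
apply/setP => -[u v]; rewrite !inE /=; case: ifP => [|_]; first lia.
by case: ifP; lia.
Qed.

Lemma OMaker_loses (n b : nat) :
  2500 <= n -> 19 * n < 20 * b.+1 -> ~ OMaker_wins n b.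
Proof.
(* The least integer above n/20, so that [b + 1 > 19n/20] gives [n < b + 1 + d]. *)
move=> n0 nb [f W]; pose d := (n %/ 20).+1.
have nd : n < 20 * d <= n + 20.
  by rewrite /d; have := divn_eq n 20; have := ltn_pmod n (isT : 0 < 20); lia.
have nC : n < b.+1 + d by lia.
apply: (good_state_not_winning n0 nd nC W (s := start_state n d) (h := [::])).
  by right; exists 0; apply: start_main_state.
by rewrite arcs_start; apply: history_start.
Qed.

Lemma t_plus_bound (n : nat) : 2500 <= n -> 20 * (t_plus n).+1 <= 19 * n.
Proof.
move=> n0; rewrite /t_plus; case: classical_sets.xgetP => [t -> [_ Wt _]|_].
  by rewrite leqNgt; apply/negP => h; apply: OMaker_loses Wt.
(* Without a threshold, [t_plus n] is the default 0. *)
by lia.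
Qed.

Local Open Scope ring_scope.

Theorem theorem1p1 :
  exists n0 : nat, forall n : nat, (n0 <= n)%N ->
    (t_plus n)%:R <= 19%:R * n%:R / 20%:R - 1 :> rat.
Proof.
exists 2500 => n /t_plus_bound.
by rewrite -(ler_nat rat) !natrM -[(t_plus n).+1%:R]natr1; lra.
Qed.
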